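(* Let $N \ge 3$, let $B_1 \subset \mathbb{R}^N$ be the unit ball centered at the origin, and let $\beta > N+2$ and $a > 1$. Then there exists a constant $C = C(\beta, a, N) > 0$ such that for every radial function $u \in C_c^2(B_1)$, $$C \int_{B_1} \frac{|u|^{\frac{N}{2}}}{|x|^N \left( \log \frac{a}{|x|} \right)^\beta} \, dx \le \int_{B_1} | \Delta u |^{\frac{N}{2}} \, dx .$$
   Context: $C_c^2(B_1)$ denotes the twice continuously differentiable real-valued functions with compact support in the open unit ball $B_1$. A function is radial if it depends only on $|x|$. *)

(* Defs.v *)
From HB Require Import structures.
From mathcomp Require Import all_boot all_order all_algebra.
From mathcomp Require Import all_classical all_reals all_analysis.

Set Implicit Arguments.
Unset Strict Implicit.
Unset Printing Implicit Defensive.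

Import Order.TTheory GRing.Theory Num.Theory.
Import numFieldTopology.Exports numFieldNormedType.Exports.

Local Open Scope classical_set_scope.
Local Open Scope ring_scope.

(* The n-fold product of the Borel sigma-algebra of R, generated by the
   coordinates; it is the Borel sigma-algebra of R^n. *)
Section measurable_rV.
Context (R : realType) (n : nat).

Definition rV_coord (i : 'I_n) (x : 'rV[R]_n) : measurableTypeR R := x ord0 i.

Let rV_set0 : g_sigma_preimage rV_coord set0.
Proof. exact: sigma_algebra0. Qed.

Let rV_setC A : g_sigma_preimage rV_coord A -> g_sigma_preimage rV_coord (~` A).
Proof. exact: sigma_algebraC. Qed.

Let rV_bigcup (F : _^nat) : (forall i, g_sigma_preimage rV_coord (F i)) ->
  g_sigma_preimage rV_coord (\bigcup_i (F i)).
Proof. exact: sigma_algebra_bigcup. Qed.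

HB.instance Definition _ := @isMeasurable.Build default_measure_display
  'rV[R]_n (g_sigma_preimage rV_coord) rV_set0 rV_setC rV_bigcup.

End measurable_rV.

Lemma measurable_rV_coord (R : realType) n (i : 'I_n) :
  measurable_fun [set: 'rV[R]_n] (rV_coord i).
Proof.
move=> _ Y mY; rewrite setTI; apply: sub_sigma_algebra => /=.
rewrite -bigcup_seq/=; exists i => /=; first by rewrite mem_index_enum.
by exists Y => //; rewrite setTI.
Qed.

Lemma measurable_fun_rVP (R : realType) d (T : measurableType d) n
    (f : T -> 'rV[R]_n) :
  (forall i, measurable_fun [set: T] (rV_coord i \o f)) ->
  measurable_fun [set: T] f.
Proof.
move=> mf.
have H : g_sigma_preimage (fun i => @rV_coord R n i \o f) `<=` measurable.
  apply: smallest_sub; first exact: sigma_algebra_measurable.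
  case: n => [|n] in f mf *; first by rewrite big_ord0.
  rewrite -bigcup_mkord_ord; apply: bigcup_sub => i Ii.
  by move=> A [B mB <-]; exact: mf.
by rewrite g_sigma_preimage_comp in H => _ A mA; apply: H; exists A.
Qed.

(* The linear isomorphism R * R^n -> R^(n+1) and its inverse. *)
Section rV_cons.
Context (R : realType) (n : nat).

Definition rV_cons (p : measurableTypeR R * 'rV[R]_n) : 'rV[R]_n.+1 :=
  \row_i if unlift ord0 i is Some j then p.2 ord0 j else p.1.

Definition rV_uncons (x : 'rV[R]_n.+1) : measurableTypeR R * 'rV[R]_n :=
  (x ord0 ord0, \row_i x ord0 (lift ord0 i)).

Lemma rV_cons0 p : rV_cons p ord0 ord0 = p.1.
Proof. by rewrite mxE unlift_none. Qed.

Lemma rV_consS p i : rV_cons p ord0 (lift ord0 i) = p.2 ord0 i.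
Proof. by rewrite mxE liftK. Qed.

Lemma rV_consK : cancel rV_cons rV_uncons.
Proof.
move=> [a x]; rewrite /rV_uncons rV_cons0; congr pair.
by apply/rowP => i; rewrite mxE rV_consS.
Qed.

Lemma rV_unconsK : cancel rV_uncons rV_cons.
Proof.
move=> x; apply/rowP => i; case: (unliftP ord0 i) => [j ->|->].
  by rewrite rV_consS mxE.
by rewrite rV_cons0.
Qed.

Lemma measurable_rV_cons : measurable_fun setT rV_cons.
Proof.
apply: measurable_fun_rVP => i; case: (unliftP ord0 i) => [j ->|->].
  rewrite (_ : _ \o _ = rV_coord j \o snd); last first.
    by apply/funext => p /=; rewrite /rV_coord rV_consS.
  exact: measurableT_comp (@measurable_rV_coord _ _ j) measurable_snd.
rewrite (_ : _ \o _ = fst); first exact: measurable_fst.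
by apply/funext => p /=; rewrite /rV_coord rV_cons0.
Qed.

Lemma measurable_rV_uncons : measurable_fun setT rV_uncons.
Proof.
apply/measurable_fun_pairP; split; first exact: (@measurable_rV_coord _ _ ord0).
apply: measurable_fun_rVP => i.
rewrite (_ : _ \o _ = rV_coord (lift ord0 i)).
  exact: measurable_rV_coord.
by apply/funext => x /=; rewrite /rV_coord mxE.
Qed.

End rV_cons.

Section lebesgue_rV_succ.
Local Open Scope ereal_scope.
Context (R : realType) (n : nat).
Variable m : {sigma_finite_measure set 'rV[R]_n -> \bar R}.

Definition lebesgue_rV_succ : set 'rV[R]_n.+1 -> \bar R :=
  pushforward (@lebesgue_measure R \x m) (@rV_cons R n).

Let mu0 : lebesgue_rV_succ set0 = 0.
Proof. by rewrite /lebesgue_rV_succ /pushforward preimage_set0 measure0. Qed.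

Let mu_ge0 A : 0 <= lebesgue_rV_succ A.
Proof. by rewrite /lebesgue_rV_succ /pushforward measure_ge0. Qed.

Let mu_additive : semi_sigma_additive lebesgue_rV_succ.
Proof.
move=> F mF tF mUF; rewrite /lebesgue_rV_succ /pushforward preimage_bigcup.
have mcons A : measurable A -> measurable (@rV_cons R n @^-1` A).
  by move=> mA; rewrite -[X in measurable X]setTI; exact: measurable_rV_cons.
apply: measure_semi_sigma_additive.
- by move=> k; exact: mcons.
- apply/trivIsetP => /= i j _ _ ij; rewrite -preimage_setI.
  by move/trivIsetP : tF => /(_ _ _ _ _ ij) ->//; rewrite preimage_set0.
- by rewrite -preimage_bigcup; exact: mcons.
Qed.

HB.instance Definition _ := isMeasure.Build _ _ _
  lebesgue_rV_succ mu0 mu_ge0 mu_additive.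

Let mu_sigma_finite : sigma_finite setT lebesgue_rV_succ.
Proof.
have /sigma_finiteP[F [TF ndF Foo]] := sigma_finiteT (@lebesgue_measure R).
have /sigma_finiteP[G [TG ndG Goo]] := sigma_finiteT m.
exists (fun k => @rV_uncons R n @^-1` (F k `*` G k)).
  rewrite -preimage_bigcup (_ : \bigcup_i _ = setT) ?preimage_setT//.
  apply/seteqP; split=> // -[x y] _.
  have [i _ Fx] : (\bigcup_i F i) x by rewrite -TF.
  have [j _ Gy] : (\bigcup_i G i) y by rewrite -TG.
  exists (maxn i j) => //; split.
    by apply: subsetPset (ndF _ _ (leq_maxl i j)) _ Fx.
  by apply: subsetPset (ndG _ _ (leq_maxr i j)) _ Gy.
move=> k; have [mF Fk] := Foo k; have [mG Gk] := Goo k; split.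
  rewrite -[X in measurable X]setTI; apply: measurable_rV_uncons => //.
  exact: measurableX.
rewrite /lebesgue_rV_succ /pushforward -comp_preimage.
rewrite (_ : _ \o _ = idfun); last by apply/funext => p /=; rewrite rV_consK.
rewrite preimage_id product_measure1E//.
by rewrite lte_mul_pinfty// ge0_fin_numE.
Qed.

HB.instance Definition _ := Measure_isSigmaFinite.Build _ _ _
  lebesgue_rV_succ mu_sigma_finite.

End lebesgue_rV_succ.

(* Lebesgue measure on R^n, as the n-fold product of Lebesgue measure on R;
   R^0 is a point of mass 1. *)
Fixpoint lebesgue_rV (R : realType) (n : nat) :
    {sigma_finite_measure set 'rV[R]_n -> \bar R} :=
  match n with
  | 0%N => [the {sigma_finite_measure set 'rV[R]_0 -> \bar R} of
              @dirac _ 'rV[R]_0 0 R]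
  | n'.+1 => [the {sigma_finite_measure set 'rV[R]_n'.+1 -> \bar R} of
              lebesgue_rV_succ (lebesgue_rV R n')]
  end.

Lemma lebesgue_rV_box (R : realType) (n : nat)
    (A : 'I_n -> set (measurableTypeR R)) : (forall i, measurable (A i)) ->
  lebesgue_rV R n [set x | forall i, A i (x ord0 i)] =
  (\prod_(i < n) lebesgue_measure (A i))%E.
Proof.
elim: n A => [|n IH] A mA.
  by rewrite big_ord0 /= diracE mem_set// => -[].
rewrite big_ord_recl -IH// /= /lebesgue_rV_succ /pushforward.
rewrite (_ : _ @^-1` _ =
  A ord0 `*` [set x : 'rV[R]_n | forall i, A (lift ord0 i) (x ord0 i)]).
  apply: product_measure1E; first exact: mA.
  rewrite (_ : [set _ | _] = \big[setI/setT]_(i < n)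
      (@rV_coord R n i @^-1` A (lift ord0 i))).
    apply: bigsetI_measurable => i _; rewrite -[X in measurable X]setTI.
    exact: measurable_rV_coord.
  rewrite -bigcap_seq; apply/seteqP; split=> x H i; first by move=> _; exact: H.
  by apply: H; rewrite /= mem_index_enum.
apply/seteqP; split=> [p H|p [H0 HS] i].
  split; first by have := H ord0; rewrite rV_cons0.
  by move=> i; have := H (lift ord0 i); rewrite rV_consS.
by case: (unliftP ord0 i) => [j ->|->]; rewrite ?rV_consS ?rV_cons0.
Qed.

Section calculus_rV.
Context (R : realType) (N : nat).
Implicit Types (u : 'rV[R]_N -> R) (x y : 'rV[R]_N).

(* The norm `|x| of the library on row vectors is the sup norm; it induces the
   same topology. *)
Definition enorm x : R := Num.sqrt (\sum_(i < N) x ord0 i ^+ 2).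

Definition unit_ball : set 'rV[R]_N := [set x | enorm x < 1].

Definition radial u := forall x y, enorm x = enorm y -> u x = u y.

Definition partial (i : 'I_N) u : 'rV[R]_N -> R :=
  fun x => 'D_(delta_mx ord0 i) u x.

Definition laplacian u : 'rV[R]_N -> R :=
  fun x => \sum_(i < N) partial i (partial i u) x.

Fixpoint Ck (k : nat) u : Prop :=
  continuous u /\ if k is k'.+1 then
    forall i : 'I_N,
      (forall x, derivable u x (delta_mx ord0 i)) /\ Ck k' (partial i u)
  else True.

Definition supp u : set 'rV[R]_N := closure [set x | u x != 0].

(* C_c^k(Omega) for Omega open, its elements being extended by 0 to R^N. *)
Definition Cc (k : nat) (Omega : set 'rV[R]_N) u :=
  [/\ Ck k u, compact (supp u) & supp u `<=` Omega].

End calculus_rV.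
Arguments unit_ball {R} N.

(* Main.v *)
Require Import Defs.
From mathcomp Require Import all_boot all_order all_algebra.
From mathcomp Require Import all_classical all_reals all_analysis.
From mathcomp Require Import measurable_realfun ring lra.

(* Write u(x) = f(|x|), omega for the volume of the unit ball and M for the
   integral of |Delta u|^(N/2) over it.  Since (s^(N-1) f')' = s^(N-1) Delta u,
   Hoelder's inequality on the ball of radius s gives
   |f'(s)| <= K M^(2/N) / s with K = (1 + 1/omega) / N, and integrating from s
   to 1, where f vanishes, |u(x)| <= K M^(2/N) log (1/|x|).  Raising this to the
   power N/2, it remains to see that |x|^(-N) log(a/|x|)^(N/2 - beta) is
   integrable, which follows by cutting the ball into the annuli
   exp(-k-1) <= |x| < exp(-k): as N/2 - beta <= -2, the k-th one contributes
   O((k+1)^(-2)).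

   Polar coordinates are avoided: Hoelder's inequality is obtained by comparing
   derivatives in s, the derivative of the integral over the ball of radius s
   being read off from the volume s^N omega of that ball. *)

Set Implicit Arguments.
Unset Strict Implicit.
Unset Printing Implicit Defensive.

Import Order.TTheory GRing.Theory Num.Theory.
Import numFieldTopology.Exports numFieldNormedType.Exports.

Local Open Scope classical_set_scope.
Local Open Scope ring_scope.

(** * Scaling of Lebesgue measure *)

(* Unification cannot find this canonical instance, as it depends on a proof
   that the map is measurable. *)
Notation pushforward_measure :=
  measure_function_pushforward__canonical__measure_function_Measure.

Lemma mscale_pushforwardE d d' (T1 : measurableType d) (T2 : measurableType d')
    (R : realType) (m : {measure set T1 -> \bar R}) (f : T1 -> T2)
    (mf : measurable_fun setT f) (k : {nonneg R}) A :
  mscale k (pushforward_measure m mf) A = (k%:num%:E * m (f @^-1` A))%E.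
Proof. by []. Qed.

Lemma lebesgue_measure_scale (R : realType) (r : R)
    (A : set (measurableTypeR R)) :
  0 < r -> measurable A ->
  lebesgue_measure A = (r%:E * lebesgue_measure ( *%R r @^-1` A))%E.
Proof.
move=> r0 mA.
have mr : measurable_fun [set: measurableTypeR R]
    ( *%R r : measurableTypeR R -> measurableTypeR R).
  exact: mulrl_measurable.
pose m' := mscale (NngNum (ltW r0))
  (pushforward_measure (@lebesgue_measure R) mr).
rewrite -(mscale_pushforwardE _ mr (NngNum (ltW r0))) -/m'.
apply: lebesgue_measure_unique => // _ [[a b] _ <-] /=.
rewrite [RHS]mscale_pushforwardE.
rewrite (_ : _ @^-1` _ = `](a / r), (b / r)]%classic); last first.
  apply/seteqP; split => x /=; rewrite !in_itv/=;
    by rewrite ltr_pdivrMr// ler_pdivlMr// mulrC.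
rewrite lebesgue_measure_itv.
rewrite [X in (_ * X)%E](lebesgue_measure_itv `](a / r), (b / r)]).
rewrite /= !lte_fin ltr_pM2r ?invr_gt0//.
case: ifPn => _; last by rewrite mule0.
by rewrite -!EFinB -EFinM -mulrBl mulrC divfK// gt_eqF.
Qed.

Lemma measurable_rV_scale (R : realType) n (r : R) :
  measurable_fun [set: 'rV[R]_n] ( *:%R r : 'rV[R]_n -> 'rV[R]_n).
Proof.
apply: measurable_fun_rVP => i.
rewrite (_ : _ \o _ = ( *%R r) \o (@rV_coord R n i)); last first.
  by apply/funext => x; rewrite /rV_coord /= mxE.
apply: measurableT_comp; last exact: measurable_rV_coord.
exact: mulrl_measurable.
Qed.

Lemma lebesgue_rV_scale (R : realType) n (r : R) (A : set 'rV[R]_n) :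
  0 < r -> measurable A ->
  lebesgue_rV R n A = ((r ^+ n)%:E * lebesgue_rV R n ( *:%R r @^-1` A))%E.
Proof.
move=> r0; elim: n A => [|n IH] A mA.
  rewrite expr0 mul1e; congr (lebesgue_rV R 0 _).
  by apply/seteqP; split => x /=; rewrite (_ : r *: x = x)//; apply/rowP => -[].
pose S (p : measurableTypeR R * 'rV[R]_n) : measurableTypeR R * 'rV[R]_n :=
  (r * p.1, r *: p.2).
have mS : measurable_fun setT S.
  apply/measurable_fun_pairP; split.
    apply: (measurableT_comp (f := *%R r)); last exact: measurable_fst.
    exact: mulrl_measurable.
  exact: measurableT_comp (@measurable_rV_scale _ _ _) measurable_snd.
have rn0 : 0 <= r ^+ n.+1 by rewrite exprn_ge0// ltW.
pose m' := mscale (NngNum rn0)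
  (pushforward_measure (@lebesgue_measure R \x lebesgue_rV R n)%E mS).
rewrite /= /lebesgue_rV_succ /pushforward.
have mA' : measurable (@rV_cons R n @^-1` A).
  by rewrite -[X in measurable X]setTI; exact: measurable_rV_cons.
rewrite (@product_measure_unique _ _ _ _ _ _ _ m')//.
  rewrite [LHS]mscale_pushforwardE; congr (_ * (_ \x _) _)%E.
  suff E p : rV_cons (S p) = r *: rV_cons p.
    by apply/seteqP; split => p /=; rewrite E.
  case: p => x y; apply/rowP => i; rewrite [RHS]mxE.
  by case: (unliftP ord0 i) => [j ->|->]; rewrite ?rV_consS ?rV_cons0//= mxE.
move=> B C mB mC; rewrite [LHS]mscale_pushforwardE.
rewrite (_ : S @^-1` _ = ( *%R r @^-1` B) `*` ( *:%R r @^-1` C)); last first.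
  by apply/seteqP; split => -[x y].
rewrite [X in (_ * X)%E]product_measure1E; last 2 first.
- by rewrite -[X in measurable X]setTI; exact: mulrl_measurable.
- by rewrite -[X in measurable X]setTI; exact: measurable_rV_scale.
rewrite [X in _ = (X * _)%E](lebesgue_measure_scale r0 mB).
rewrite [X in _ = (_ * X)%E](IH C mC) /= exprS EFinM.
by rewrite muleACA.
Qed.

Lemma measurable_enorm (R : realType) n : measurable_fun setT (@enorm R n).
Proof.
apply: measurableT_comp.
  by apply: continuous_measurable_fun; exact: sqrt_continuous.
apply: measurable_sum => i; apply: measurable_funX.
exact: (@measurable_rV_coord R n i).
Qed.

Lemma enorm_ge0 (R : realType) n (x : 'rV[R]_n) : 0 <= enorm x.
Proof. exact: sqrtr_ge0. Qed.

Lemma enormZ (R : realType) n (r : R) (x : 'rV[R]_n) :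
  enorm (r *: x) = `|r| * enorm x.
Proof.
rewrite /enorm -sqrtr_sqr -sqrtrM ?sqr_ge0// mulr_sumr.
by congr Num.sqrt; apply: eq_bigr => i _; rewrite mxE exprMn.
Qed.

Lemma coord_le_enorm (R : realType) n (x : 'rV[R]_n) i : `|x ord0 i| <= enorm x.
Proof.
rewrite -sqrtr_sqr ler_wsqrtr// (bigD1 i)//= lerDl sumr_ge0// => j _.
exact: sqr_ge0.
Qed.

Lemma measurable_enorm_preimage (R : realType) n (A : set (measurableTypeR R)) :
  measurable A -> measurable (@enorm R n @^-1` A).
Proof.
by move=> mA; rewrite -[X in measurable X]setTI; exact: measurable_enorm.
Qed.

Lemma measurable_rV_box (R : realType) n
    (A : 'I_n -> set (measurableTypeR R)) : (forall i, measurable (A i)) ->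
  measurable [set x : 'rV[R]_n | forall i, A i (x ord0 i)].
Proof.
move=> mA; have -> : [set x : 'rV[R]_n | forall i, A i (x ord0 i)] =
    \bigcap_(i in setT) (@rV_coord R n i @^-1` A i).
  by apply/seteqP; split=> x /= H i => [_|]; exact: H.
apply: fin_bigcap_measurable => // i _; rewrite -[X in measurable X]setTI.
exact: measurable_rV_coord.
Qed.

Lemma lebesgue_rV_unit_ball_fin (R : realType) n :
  lebesgue_rV R n (unit_ball n) \is a fin_num.
Proof.
rewrite ge0_fin_numE//; apply: (@le_lt_trans _ _
  (lebesgue_rV R n [set x | forall i,
    (`[-1, 1]%classic : set (measurableTypeR R)) (x ord0 i)])).
  apply: le_measure; rewrite ?inE.
  - exact: (@measurable_enorm_preimage _ _ `]-oo, 1[%classic).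
  - exact: (@measurable_rV_box _ _ (fun=> `[-1, 1]%classic)).
  move=> x /= x1 i; rewrite in_itv/= -ler_norml.
  by rewrite (le_trans (coord_le_enorm _ i))// ltW.
rewrite (@lebesgue_rV_box _ _ (fun=> `[-1, 1]%classic))//.
rewrite (eq_bigr (fun=> (1 - -1 : R)%:E)).
  by rewrite prodEFin ltry.
by move=> i _; rewrite lebesgue_measure_itv/= lte_fin ifT// ltrN10 ltr01.
Qed.

Lemma lebesgue_rV_unit_ball_gt0 (R : realType) n :
  (0 < lebesgue_rV R n (unit_ball n))%E.
Proof.
pose e : R := (n.+1%:R)^-1.
have e0 : 0 < e by rewrite invr_gt0.
apply: (@lt_le_trans _ _
  (lebesgue_rV R n [set x | forall i,
    (`[0, e]%classic : set (measurableTypeR R)) (x ord0 i)])).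
  rewrite (@lebesgue_rV_box _ _ (fun=> `[0, e]%classic))//.
  rewrite (eq_bigr (fun=> e%:E)).
    by rewrite prodEFin lte_fin prodr_gt0.
  by move=> i _; rewrite lebesgue_measure_itv/= lte_fin e0 oppr0 adde0.
apply: le_measure; rewrite ?inE.
- exact: (@measurable_rV_box _ _ (fun=> `[0, e]%classic)).
- exact: (@measurable_enorm_preimage _ _ `]-oo, 1[%classic).
move=> x /= H; rewrite /unit_ball/= /enorm -[ltRHS]sqrtr1 ltr_sqrt//.
apply: (@le_lt_trans _ _ (\sum_(i < n) e)).
  apply: ler_sum => i _; have := H i; rewrite in_itv/= => /andP[x0 xe].
  have e1 : e <= 1 by rewrite invf_le1// ler1n.
  by rewrite expr2 (le_trans _ (_ : e * e <= e))// ?ler_pM//ler_piMr// ltW.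
by rewrite sumr_const card_ord -mulr_natl /e ltr_pdivrMr// mul1r ltr_nat.
Qed.

Definition ball_vol (R : realType) n : R :=
  fine (lebesgue_rV R n (unit_ball n)).

Lemma ball_vol_gt0 (R : realType) n : 0 < ball_vol R n.
Proof.
rewrite fine_gt0// lebesgue_rV_unit_ball_gt0/=.
by have := lebesgue_rV_unit_ball_fin R n; rewrite ge0_fin_numE.
Qed.

Lemma lebesgue_rV_ball (R : realType) n (s : R) : 0 < s ->
  lebesgue_rV R n [set x | enorm x < s] = (s ^+ n * ball_vol R n)%:E.
Proof.
move=> s0; rewrite EFinM fineK ?lebesgue_rV_unit_ball_fin//.
rewrite [in RHS](@lebesgue_rV_scale _ _ (s^-1))//; last 2 first.
- by rewrite invr_gt0.
- exact: (@measurable_enorm_preimage _ _ `]-oo, 1[%classic).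
rewrite muleA -EFinM -exprMn divff ?gt_eqF// expr1n mul1e.
congr (lebesgue_rV R n _); apply/seteqP; split => x /=;
  by rewrite /unit_ball/= enormZ gtr0_norm ?invr_gt0// mulrC ltr_pdivrMr//
     mul1r.
Qed.

(** * Integrals of radial functions over balls *)

Section radial_integral.
Context (R : realType) (n : nat) (phi : R -> R).
Local Notation mu := (lebesgue_rV R n).
Local Notation omega := (ball_vol R n).
Hypotheses (phi0 : forall r, 0 <= phi r) (cphi : continuous phi).
Hypothesis phi_int :
  (\int[mu]_(x in unit_ball n) (phi (enorm x))%:E < +oo)%E.

Definition ball_integral t : R :=
  fine (\int[mu]_(x in [set x | (enorm x < t)%R]) (phi (enorm x))%:E)%E.

Let mphi : measurable_fun [set: 'rV[R]_n] (fun x => (phi (enorm x))%:E).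
Proof.
apply/measurable_EFinP; apply: measurableT_comp; last exact: measurable_enorm.
exact: continuous_measurable_fun.
Qed.

Let mball t : measurable [set x : 'rV[R]_n | enorm x < t].
Proof. exact: (@measurable_enorm_preimage _ _ `]-oo, t[%classic). Qed.

Let phi0E (x : 'rV[R]_n) : (0 <= (phi (enorm x))%:E)%E.
Proof. by rewrite lee_fin. Qed.

Lemma ball_integralE t : t <= 1 ->
  (ball_integral t)%:E =
  (\int[mu]_(x in [set x | (enorm x < t)%R]) (phi (enorm x))%:E)%E.
Proof.
move=> t1; rewrite fineK// ge0_fin_numE ?integral_ge0//.
apply: le_lt_trans phi_int; apply: ge0_subset_integral => //.
- exact: mball.
- exact: measurable_funS mphi.
by move=> x /= /lt_le_trans; exact.
Qed.

Lemma ball_integral_ge0 t : 0 <= ball_integral t.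
Proof. by rewrite fine_ge0// integral_ge0. Qed.

Lemma ball_integral_le t : t <= 1 -> ball_integral t <= ball_integral 1.
Proof.
move=> t1; rewrite -lee_fin !ball_integralE//.
apply: ge0_subset_integral => //; first exact: measurable_funS mphi.
by move=> x /= /lt_le_trans; exact.
Qed.

Lemma measurable_annulus s t :
  measurable [set x : 'rV[R]_n | s <= enorm x < t].
Proof.
rewrite (_ : [set x | _] = @enorm R n @^-1` `[s, t[%classic).
  exact: measurable_enorm_preimage.
by apply/seteqP; split=> x /=; rewrite in_itv.
Qed.
#[local] Hint Resolve measurable_annulus : core.

Let ball_split s t : s <= t -> [set x : 'rV[R]_n | enorm x < t] =
  [set x | enorm x < s] `|` [set x | s <= enorm x < t].
Proof.
move=> st; apply/seteqP; split=> x /=.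
  by move=> xt; have [xs|sx] := ltP (enorm x) s; [left|right; rewrite xt].
by case=> [xs|/andP[]//]; exact: lt_le_trans xs st.
Qed.

Lemma lebesgue_rV_annulus s t : 0 < s -> s <= t ->
  mu [set x | s <= enorm x < t] = ((t ^+ n - s ^+ n) * omega)%:E.
Proof.
move=> s0 st.
have := lebesgue_rV_ball n (lt_le_trans s0 st).
rewrite (ball_split st).
rewrite measureU//; last first.
  by apply/seteqP; split=> x //= -[xs /andP[]]; rewrite leNgt xs.
rewrite [X in (X + _)%E]lebesgue_rV_ball// => /eqP.
rewrite eq_sym addeC -sube_eq//; last by rewrite fin_num_adde_defl.
by rewrite -EFinB -mulrBl => /eqP <-.
Qed.

Lemma ball_integral_sub s t c e : 0 < s -> s <= t -> t <= 1 ->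
  (forall r, s <= r < t -> `|phi r - c| <= e) ->
  `|ball_integral t - ball_integral s - c * ((t ^+ n - s ^+ n) * omega)|
    <= e * ((t ^+ n - s ^+ n) * omega).
Proof.
move=> s0 st t1 H.
set V := (_ - _) * omega.
have V0 : 0 <= V.
  rewrite mulr_ge0 ?(ltW (ball_vol_gt0 _ _))// subr_ge0 lerXn2r// nnegrE ltW//.
  exact: lt_le_trans st.
pose I := (\int[mu]_(x in [set x | (s <= enorm x < t)%R]) (phi (enorm x))%:E)%E.
have IE : (ball_integral t)%:E = ((ball_integral s)%:E + I)%E.
  rewrite !ball_integralE ?(le_trans st)//.
  rewrite (ball_split st).
  rewrite ge0_integral_setU//.
  - exact: measurable_funS mphi.
  - by apply/disj_setPS => x /= -[xs /andP[]]; rewrite leNgt xs.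
have {IE}IE : I = (ball_integral t - ball_integral s)%:E.
  by rewrite EFinB IE addeAC subee// add0e.
have cstI k :
    (\int[mu]_(x in [set x | (s <= enorm x < t)%R]) (cst k%:E) x =
     (k * V)%:E)%E.
  by rewrite integral_cst// EFinM; congr (_ * _)%E; exact: lebesgue_rV_annulus.
have lo : (c - e) * V <= ball_integral t - ball_integral s.
  apply: (@le_trans _ _ (Num.max 0 (c - e) * V)).
    by rewrite ler_wpM2r// le_max lexx orbT.
  rewrite -lee_fin -IE -cstI; apply: ge0_le_integral => //.
  - by move=> x _; rewrite lee_fin le_max lexx.
  - exact: measurable_funS mphi.
  move=> x /H; rewrite ler_norml lee_fin ge_max phi0 => /andP[+ _] /=.
  by rewrite lerBrDl.
have hi : ball_integral t - ball_integral s <= (c + e) * V.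
  rewrite -lee_fin -IE -cstI; apply: ge0_le_integral => //.
  - exact: measurable_funS mphi.
  move=> x /H; rewrite ler_norml lee_fin => /andP[_] /=.
  by rewrite lerBlDl.
by rewrite ler_norml; apply/andP; split; lra.
Qed.

Lemma is_derive_ball_integral (t : R) : 0 < t < 1 ->
  is_derive t 1 ball_integral (phi t * (n%:R * t ^+ n.-1 * omega)).
Proof.
move=> /andP[t0 t1].
pose V (x : R) := x ^+ n * omega.
set v := n%:R * _ * _.
have dV : is_derive t 1 V v.
  rewrite (_ : V = omega \*: (@id R ^+ n)); last first.
    by apply/funext => x; rewrite /V mulrC fctE.
  apply: is_derive_eq; rewrite /GRing.scale/= mulr1.
  by rewrite mulrC.
suff H : (h^-1 *: (ball_integral (h *: (1 : R) + t) - ball_integral t))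
    @[h --> 0^'] --> phi t * v.
  split; last exact/cvg_lim.
  by apply/cvg_ex; exists (phi t * v); exact: H.
have cV : (h^-1 *: (V (h *: (1 : R) + t) - V t)) @[h --> 0^'] --> v.
  have [+ <-] := dV; exact.
have v0 : 0 <= v.
  by rewrite !mulr_ge0 ?exprn_ge0 ?(ltW t0) ?(ltW (ball_vol_gt0 _ _)).
apply/cvgrPdist_le => e e0.
pose d1 := Num.min 1 (e / (2 * (`|phi t| + 1))).
pose d2 := e / (2 * (v + 1)).
have d10 : 0 < d1.
  by rewrite lt_min ltr01 divr_gt0// mulr_gt0// ltr_wpDl.
have d20 : 0 < d2 by rewrite divr_gt0// mulr_gt0// ltr_wpDl.
have [eta /= eta0 Heta] : exists2 eta : R, 0 < eta &
    forall r, `|t - r| < eta -> `|phi r - phi t| <= d2.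
  have /cvgrPdist_le/(_ _ d20)[eta /= eta0 H] := @cphi t.
  by exists eta => // r /H; rewrite distrC.
have Hs s u : t - eta < s -> 0 < s -> s < u -> u < t + eta -> u <= 1 ->
    `|ball_integral u - ball_integral s - phi t * (V u - V s)|
    <= d2 * (V u - V s).
  move=> st s0 su ut u1; rewrite /V -mulrBl.
  apply: ball_integral_sub => //; first exact: ltW.
  move=> r /andP[sr ru]; apply: Heta.
  by rewrite ltr_norml; apply/andP; split; lra.
have hB (k : R) : 0 < k -> \forall h \near (0 : R)^', `|h| < k.
  by exact: dnbhs0_lt.
near=> h.
have h0 : h != 0 by near: h; exact: nbhs_dnbhs_neq.
have hV : `|v - h^-1 *: (V (h *: (1 : R) + t) - V t)| <= d1.
  by near: h; move/cvgrPdist_le : cV; exact.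
move: hV; rewrite /GRing.scale/= mulr1.
set DV := V _ - V t; set DP := ball_integral _ - _ => hV.
have key : `|DP - phi t * DV| <= d2 * `|DV|.
  have [he ht ht'] : [/\ `|h| < eta, `|h| < t & `|h| < 1 - t].
    by split; near: h; apply: hB => //; rewrite subr_gt0.
  move: he ht ht'; rewrite !ltr_norml => /andP[? ?] /andP[? ?] /andP[? ?].
  have [hlt|hgt|h00] := ltgtP h 0.
  - have := @Hs (h + t) t ltac:(lra) ltac:(lra) ltac:(lra) ltac:(lra)
      ltac:(lra).
    have -> : V t - V (h + t) = - DV by rewrite opprB.
    have -> : ball_integral t - ball_integral (h + t) = - DP by rewrite opprB.
    rewrite mulrN -opprD normrN => H.
    rewrite [`|DV|]ler0_norm//.
    by have := le_trans (normr_ge0 _) H; rewrite pmulr_rge0// oppr_ge0.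
  - have H := @Hs t (h + t) ltac:(lra) ltac:(lra) ltac:(lra) ltac:(lra)
      ltac:(lra).
    rewrite [`|DV|]ger0_norm//.
    by have := le_trans (normr_ge0 _) H; rewrite pmulr_rge0.
  by rewrite h00 eqxx in h0.
have {}key : `|h^-1 * DP - phi t * (h^-1 * DV)| <= d2 * `|h^-1 * DV|.
  rewrite mulrCA -mulrBr !normrM mulrCA.
  by rewrite ler_wpM2l.
have dv : `|h^-1 * DV| <= v + 1.
  have : d1 <= 1 by rewrite ge_min lexx.
  rewrite -[h^-1 * DV](subKr v) => d11.
  by rewrite (le_trans (ler_normB _ _))// ger0_norm// lerD2l (le_trans hV).
have E : phi t * v - h^-1 * DP =
    phi t * (v - h^-1 * DV) - (h^-1 * DP - phi t * (h^-1 * DV)) by ring.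
rewrite E (le_trans (ler_normB _ _))// (splitr e) lerD//.
  have : d1 <= e / (2 * (`|phi t| + 1)) by rewrite ge_min lexx orbT.
  rewrite normrM => d1e.
  rewrite (@le_trans _ _ ((`|phi t| + 1) * (e / (2 * (`|phi t| + 1)))))//.
    by rewrite ler_pM// ?lerDl// (le_trans hV).
  rewrite le_eqVlt; apply/orP; left; apply/eqP; field.
  by rewrite gt_eqF// ltr_wpDl.
rewrite (le_trans key)// (@le_trans _ _ (d2 * (v + 1)))//.
  by rewrite ler_wpM2l// ltW.
rewrite le_eqVlt; apply/orP; left; apply/eqP; rewrite /d2; field.
by rewrite gt_eqF// ltr_wpDl.
Unshelve. all: by end_near.
Qed.

End radial_integral.

(** * The Laplacian of a radial function *)

Section radial_laplacian.
Context (R : realType) (N : nat).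
Implicit Types (u : 'rV[R]_N -> R) (x : 'rV[R]_N).

Lemma is_derive_line u x d t : derivable u (x + t *: d) d ->
  is_derive t (1 : R) (fun s : R => u (x + s *: d)) ('D_d u (x + t *: d)).
Proof.
move=> ud.
have E : (fun h : R => h^-1 *: (((fun s : R => u (x + s *: d)) \o shift t)
      (h *: (1 : R)) - u (x + t *: d))) =
    (fun h : R => h^-1 *: ((u \o shift (x + t *: d)) (h *: d)
      - u (x + t *: d))).
  apply/funext => h /=; congr (_ *: (u _ - _)).
  by rewrite -[h *: 1]/(h * 1) mulr1 scalerDl addrCA.
split; first by rewrite /derivable E.
by rewrite /derive E.
Qed.

Lemma enorm_line x i (s : R) :
  enorm (x + s *: delta_mx ord0 i) =
  Num.sqrt (enorm x ^+ 2 + 2 * x ord0 i * s + s ^+ 2).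
Proof.
rewrite /enorm sqr_sqrtr; last by rewrite sumr_ge0// => j _; exact: sqr_ge0.
congr Num.sqrt; rewrite (bigD1 i)//= [in RHS](bigD1 i)//= !mxE !eqxx/= mulr1.
rewrite (eq_bigr (fun j => x ord0 j ^+ 2)); last first.
  by move=> j ji; rewrite !mxE (negbTE ji) mulr0 addr0.
by rewrite sqrrD; ring.
Qed.

Lemma enorm0 : enorm (0 : 'rV[R]_N) = 0.
Proof. by rewrite /enorm big1 ?sqrtr0// => i _; rewrite mxE expr0n. Qed.

Lemma enorm_gt0P x : reflect (x <> 0) (0 < enorm x).
Proof.
rewrite lt_def enorm_ge0 andbT; apply: (iffP idP) => [+ x0|x0].
  by rewrite x0 enorm0 eqxx.
apply: contra_notN x0 => /eqP x0; apply/rowP => i; rewrite mxE.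
by apply/eqP; rewrite -normr_le0 -x0 coord_le_enorm.
Qed.

Lemma is_derive_enorm_line x i : 0 < enorm x ->
  is_derive (0 : R) (1 : R) (fun s : R => enorm (x + s *: delta_mx ord0 i))
    (x ord0 i / enorm x).
Proof.
move=> x0; under [fun s => _]funext do rewrite enorm_line.
pose q : R -> R := cst (enorm x ^+ 2) + (2 * x ord0 i) \*: id + id ^+ 2.
have q0 : q 0 = enorm x ^+ 2.
  by rewrite /q !fctE /= [_ *: _]mulr0 expr0n/= !addr0.
have dq : is_derive (0 : R) 1 q (2 * x ord0 i).
  have := is_deriveD (is_deriveD (is_derive_cst (enorm x ^+ 2) (0 : R) (1 : R))
    (is_deriveZ (2 * x ord0 i) (is_derive_id (0 : R) (1 : R))))
    (is_deriveX 2 (is_derive_id (0 : R) (1 : R))).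
  by rewrite /= !scaler1 mulr0 addr0 add0r.
have ds : is_derive (q 0) 1 Num.sqrt (2 * enorm x)^-1.
  have -> : enorm x = Num.sqrt (q 0).
    by rewrite q0 sqrtr_sqr ger0_norm ?enorm_ge0.
  by apply: is_derive1_sqrt; rewrite q0 exprn_gt0.
have := is_derive1_comp ds dq.
by rewrite (_ : _^-1 * _ = x ord0 i / enorm x)//; field; rewrite gt_eqF.
Qed.

Variables (u : 'rV[R]_N -> R) (i0 : 'I_N).
Hypotheses (u2 : Ck 2 u) (ru : radial u).
Let e : 'rV[R]_N := delta_mx ord0 i0.

Lemma enorm_delta : enorm e = 1.
Proof.
rewrite /enorm (bigD1 i0)//= big1 ?addr0 ?mxE ?eqxx ?expr1n ?sqrtr1//.
by move=> j ji; rewrite mxE (negbTE ji) expr0n.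
Qed.

Lemma enorm_ray (t : R) : enorm (t *: e) = `|t|.
Proof. by rewrite enormZ enorm_delta mulr1. Qed.

Definition profile (t : R) := u (t *: e).
Definition profile' (t : R) := partial i0 u (t *: e).
Definition profile'' (t : R) := partial i0 (partial i0 u) (t *: e).
Definition lap_profile (t : R) := laplacian u (t *: e).

Lemma profileE x : u x = profile (enorm x).
Proof. by apply: ru; rewrite enorm_ray ger0_norm ?enorm_ge0. Qed.

Lemma is_derive_profile (t : R) : is_derive t 1 profile (profile' t).
Proof.
have [_ /(_ i0)[/(_ (0 + t *: e)) du _]] := u2.
have := is_derive_line du.
by under [fun s => _]funext do rewrite add0r; rewrite add0r.
Qed.

Lemma is_derive_profile' (t : R) : is_derive t 1 profile' (profile'' t).
Proof.
have [_ /(_ i0)[_ [_ /(_ i0)[/(_ (0 + t *: e)) du _]]]] := u2.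
have := is_derive_line du.
by under [fun s => _]funext do rewrite add0r; rewrite add0r.
Qed.

Lemma partial_radial x i : 0 < enorm x ->
  partial i u x = profile' (enorm x) * (x ord0 i / enorm x).
Proof.
move=> x0; have [_ /(_ i)[/(_ (x + 0 *: delta_mx ord0 i)) du _]] := u2.
have [_ d1] := is_derive_line du.
have dx := is_derive_enorm_line i x0.
pose rho (s : R) := enorm (x + s *: delta_mx ord0 i).
have df : is_derive (rho 0) 1 profile (profile' (enorm x)).
  by rewrite /rho scale0r addr0; exact: is_derive_profile.
have [_ d2] := is_derive1_comp (g := rho) df dx.
rewrite -d2 -[in LHS](addr0 x) -(scale0r (delta_mx ord0 i)) /partial -d1.
by congr ('D_(1 : R) _ (0 : R)); apply/funext => s /=; rewrite -profileE.
Qed.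

Lemma partial2_radial x i : 0 < enorm x ->
  partial i (partial i u) x =
  profile'' (enorm x) * (x ord0 i ^+ 2 / enorm x ^+ 2) +
  profile' (enorm x) * ((enorm x)^-1 - x ord0 i ^+ 2 / enorm x ^+ 3).
Proof.
move=> x0.
have [_ /(_ i)[_ [_ /(_ i)[/(_ (x + 0 *: delta_mx ord0 i)) du _]]]] := u2.
have [_ d1] := is_derive_line du.
have dx := is_derive_enorm_line i x0.
pose rho (s : R) := enorm (x + s *: delta_mx ord0 i).
have rho0 : rho 0 = enorm x by rewrite /rho scale0r addr0.
have df : is_derive (rho 0) 1 profile' (profile'' (enorm x)).
  by rewrite rho0; exact: is_derive_profile'.
have d2 := is_derive1_comp (g := rho) df dx.
have rhoN0 : rho 0 != 0 by rewrite rho0 gt_eqF.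
have d3 := is_deriveV rhoN0 dx.
have d4 : is_derive (0 : R) 1 (fun s : R => x ord0 i + s) 1.
  have := is_deriveD (is_derive_cst (x ord0 i) (0 : R) (1 : R))
    (is_derive_id (0 : R) (1 : R)).
  by rewrite add0r.
have [_ d5] := is_deriveM d2 (is_deriveM d4 d3).
rewrite /= rho0 in d5.
have x00 : x + 0 *: delta_mx ord0 i = x by rewrite scale0r addr0.
have -> : partial i (partial i u) x =
    'D_(delta_mx ord0 i) (partial i u) (x + 0 *: delta_mx ord0 i).
  rewrite x00; reflexivity.
have crho : {for (0 : R), continuous rho}.
  by apply/differentiable_continuous/derivable1_diffP; case: dx.
rewrite -d1 (_ : 'D_(1 : R) _ _ = 'D_(1 : R) ((profile' \o rho) *
    ((fun s : R => x ord0 i + s) * (fun y => (rho y)^-1))) (0 : R)); last first.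
  apply: near_eq_derive.
  near=> s; rewrite partial_radial; last first.
    rewrite -/(rho s); near: s.
    have := @cvgr_gt _ _ _ _ _ _ crho; apply; by rewrite rho0.
  by rewrite !fctE /= !mxE !eqxx/= mulr1.
rewrite d5 fctE /= rho0 addr0 /GRing.scale/=.
by field; rewrite gt_eqF.
Unshelve. all: by end_near.
Qed.

Lemma laplacian_radial x : 0 < enorm x ->
  laplacian u x =
  profile'' (enorm x) + (N%:R - 1) / enorm x * profile' (enorm x).
Proof.
move=> x0; rewrite /laplacian.
under eq_bigr => i _ do rewrite partial2_radial//.
rewrite big_split/= -!mulr_sumr sumrB sumr_const card_ord -!mulr_suml.
have -> : \sum_(i < N) x ord0 i ^+ 2 = enorm x ^+ 2.
  by rewrite sqr_sqrtr// sumr_ge0// => i _; exact: sqr_ge0.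
by rewrite -mulr_natl; field; rewrite gt_eqF.
Qed.

Lemma lap_profileE x : laplacian u x = lap_profile (enorm x).
Proof.
have [->|/eqP x0] := eqVneq x 0; first by rewrite enorm0 /lap_profile scale0r.
have {}x0 : 0 < enorm x by apply/enorm_gt0P.
have E : enorm (enorm x *: e) = enorm x.
  by rewrite enorm_ray ger0_norm ?enorm_ge0.
by rewrite /lap_profile (laplacian_radial x0) laplacian_radial E.
Qed.

Lemma continuous_lap_profile : continuous lap_profile.
Proof.
suff c : continuous (laplacian u).
  by move=> t; apply: continuous_comp; [exact: scalel_continuous|exact: c].
have -> : laplacian u = \sum_(i < N) partial i (partial i u).
  by apply/funext => x; rewrite fct_sumE.
elim/big_ind : _ => [|f g cf cg x|i _].
- exact: cst_continuous.
- exact: (@cvgD _ _ _ (nbhs x) _ f g _ _ (@cf x) (@cg x)).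
by have [_ /(_ i)[_ [_ /(_ i)[_ [c _]]]]] := u2.
Qed.

Lemma is_derive_weighted_profile' (t : R) : 0 < t ->
  is_derive t 1 (fun s => s ^+ N.-1 * profile' s) (t ^+ N.-1 * lap_profile t).
Proof.
move=> t0; have -> : (fun s => s ^+ N.-1 * profile' s) = id ^+ N.-1 * profile'.
  by apply/funext => s; rewrite !fctE.
have := is_deriveM (is_deriveX N.-1 (is_derive_id t (1 : R)))
  (is_derive_profile' t).
suff -> : t ^+ N.-1 * lap_profile t = (id ^+ N.-1) t *: profile'' t +
    profile' t *: ((N.-1%:R * id t ^+ N.-1.-1) *: 1) by [].
have et : enorm (t *: e) = t by rewrite enorm_ray gtr0_norm.
rewrite /lap_profile laplacian_radial et//.
have N0 : (0 < N)%N by case: (N) i0 => // -[].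
have -> : N%:R - 1 = N.-1%:R :> R by rewrite -{1}(prednK N0) mulrSr addrK.
rewrite exprfctE /GRing.scale/= mulr1 mulrDr; congr (_ + _).
case: N.-1 => [|k]; first by rewrite !mul0r !mulr0.
by rewrite /= exprS; field; rewrite gt_eqF.
Qed.

End radial_laplacian.

(** * The pointwise bound *)

Lemma derive_ge0_le (R : realType) (h dh : R -> R) (a b : R) : a <= b ->
  (forall x, a <= x <= b -> is_derive x 1 h (dh x)) ->
  (forall x, a < x < b -> 0 <= dh x) -> h a <= h b.
Proof.
move=> ab hd h0.
apply: (@ger0_derive1_le_cc R h a b) => //.
- by move=> x /[!in_itv]/= /andP[/ltW ax /ltW xb]; have [] := hd x; rewrite ?ax.
- move=> x /[!in_itv]/= axb; have /andP[/ltW ax /ltW xb] := axb.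
  by rewrite derive1E; have [|_ ->] := hd x; rewrite ?ax//; exact: h0.
- apply: derivable_within_continuous => x /[!in_itv]/= axb.
  by have [] := hd x axb.
- by rewrite in_itv/= lexx.
- by rewrite in_itv/= lexx andbT.
Qed.

(* In place of Young's inequality. *)
Lemma sqr_exprn_le (R : realDomainType) (v w : R) n :
  (2 <= n)%N -> 0 <= v -> 0 <= w ->
  v ^+ 2 * w ^+ (n - 2) <= w ^+ n + v ^+ n.
Proof.
move=> n2 v0 w0; have nE := subnKC n2.
have [vw|/ltW wv] := leP v w.
- rewrite -[in leRHS]nE ler_wpDr ?exprn_ge0//.
  by rewrite exprD ler_wpM2r ?exprn_ge0// lerXn2r.
- rewrite -[in leRHS]nE ler_wpDl ?exprn_ge0//.
  by rewrite [leRHS]exprD ler_wpM2l ?exprn_ge0// lerXn2r.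
Qed.

Section pointwise_bound.
Context (R : realType) (N : nat) (u : 'rV[R]_N -> R) (i0 : 'I_N).
Hypotheses (N2 : (2 <= N)%N) (u2 : Ck 2 u) (ru : radial u).
Local Notation mu := (lebesgue_rV R N).
Local Notation omega := (ball_vol R N).

(* [|Delta u|^(N/2)], without real exponents. *)
Definition lap_pow (t : R) := Num.sqrt `|lap_profile u i0 t| ^+ N.

Lemma lap_pow_ge0 t : 0 <= lap_pow t.
Proof. by rewrite exprn_ge0 ?sqrtr_ge0. Qed.

Lemma continuous_lap_pow : continuous lap_pow.
Proof.
move=> t.
apply: (@continuous_comp _ _ _ (fun s => Num.sqrt `|lap_profile u i0 s|)
  (fun x => x ^+ N)); last exact: exprn_continuous.
apply: (@continuous_comp _ _ _ (fun s => `|lap_profile u i0 s|));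
  last exact: sqrt_continuous.
apply: (@continuous_comp _ _ _ (lap_profile u i0));
  last exact: norm_continuous.
exact: continuous_lap_profile.
Qed.

Hypothesis lap_int :
  (\int[mu]_(x in unit_ball N) (lap_pow (enorm x))%:E < +oo)%E.

Let Phi := ball_integral N lap_pow.

(* Hoelder's inequality for [s^(N-1) f'(s)], the integral over [0, s] of
   [t^(N-1) Delta u], before optimisation in [w]. *)
Lemma weighted_profile_le (w s b : R) : 0 < w -> 0 < s < 1 -> `|b| <= 1 ->
  b * w ^+ (N - 2) * (s ^+ N.-1 * profile' u i0 s) <=
  (w ^+ N * s ^+ N + Phi s / omega) / N%:R.
Proof.
move=> w0 /andP[s0 s1] b1; have o0 := ball_vol_gt0 R N.
have N0 : 0 < N%:R :> R by rewrite ltr0n (leq_trans _ N2).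
pose W (t : R) := (w ^+ N * t ^+ N + Phi t / omega) / N%:R.
pose k := b * w ^+ (N - 2).
pose F (t : R) := t ^+ N.-1 * profile' u i0 t.
pose H (t : R) := W t - k * F t.
pose dH (t : R) := t ^+ N.-1 * (w ^+ N + lap_pow t - k * lap_profile u i0 t).
have HdH (t : R) : 0 < t < 1 -> is_derive t 1 H (dH t).
  move=> /[dup] t01 /andP[t0 t1].
  have dF := is_derive_weighted_profile' i0 u2 ru t0.
  have dP := is_derive_ball_integral lap_pow_ge0 (@continuous_lap_pow)
    lap_int t01.
  have -> : H = (w ^+ N / N%:R) \*: (id ^+ N) + (omega^-1 / N%:R) \*: Phi
      - k \*: F.
    apply/funext => x; rewrite /H /W /GRing.scale !fctE/=.
    rewrite -[w ^+ N / N%:R *: _]/(_ * _) -[omega^-1 / N%:R *: _]/(_ * _).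
    by rewrite -[k *: _]/(_ * _); ring.
  have := is_deriveB (is_deriveD
    (is_deriveZ (w ^+ N / N%:R) (is_deriveX N (is_derive_id t (1 : R))))
    (is_deriveZ (omega^-1 / N%:R) dP)) (is_deriveZ k dF).
  rewrite (_ : _ - _ = dH t)//.
  rewrite scaler1 /dH /GRing.scale/=; field.
  by rewrite !gt_eqF.
have dH0 (t : R) : 0 < t -> 0 <= dH t.
  move=> t0; rewrite mulr_ge0 ?exprn_ge0 ?(ltW t0)// subr_ge0.
  apply: le_trans (ler_norm _) _.
  rewrite !normrM (ger0_norm (exprn_ge0 _ (ltW w0))).
  rewrite -mulrA (le_trans (ler_piMl _ b1)) ?mulr_ge0 ?exprn_ge0 ?(ltW w0)//.
  rewrite mulrC -[X in X * _ <= _]sqr_sqrtr//.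
  by apply: sqr_exprn_le => //; rewrite ?sqrtr_ge0// ltW.
have Hr (r : R) : 0 < r -> r <= s -> - (k * F r) <= H s.
  move=> r0 rs; apply: (@le_trans _ _ (H r)).
    rewrite lerDr divr_ge0 ?ler0n// addr_ge0//.
      by rewrite mulr_ge0 ?exprn_ge0// ltW.
    rewrite divr_ge0 ?(ltW o0)//; apply: ball_integral_ge0.
    exact: lap_pow_ge0.
  apply: (derive_ge0_le rs (dh := dH)) => t /andP[rt ts].
    by apply: HdH; rewrite (lt_le_trans r0)//= (le_lt_trans ts).
  by apply: dH0; rewrite (lt_trans r0).
suff : 0 <= H s by rewrite subr_ge0.
rewrite leNgt; apply/negP => Hs0.
have cF : {for (0 : R), continuous (fun t : R => - (k * F t))}.
  apply: continuousN; apply: continuousM; first exact: cst_continuous.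
  apply: continuousM; first exact: exprn_continuous.
  apply/differentiable_continuous/derivable1_diffP.
  by have [] := is_derive_profile' i0 u2 (0 : R).
have F0 : - (k * F 0) = 0.
  rewrite /F expr0n (_ : N.-1 == 0%N = false) ?mul0r ?mulr0 ?oppr0//.
  by case: (N) N2 => [|[]].
have : \forall r \near (0 : R)^'+, H s < - (k * F r).
  have := cvg_at_right_filter cF => /cvgr_gt; apply.
  by rewrite F0.
move=> nr; near (0 : R)^'+ => r.
have : H s < - (k * F r) by near: r.
have r0 : 0 < r by near: r; exact: nbhs_right_gt.
have rs : r <= s by near: r; exact: nbhs_right_le.
by rewrite ltNge Hr.
Unshelve. all: by end_near.
Qed.

Let K := (1 + omega^-1) / N%:R.

Lemma profile'_le (m s : R) : 0 < m -> Phi 1 <= m ^+ N -> 0 < s < 1 ->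
  `|profile' u i0 s| <= K * m ^+ 2 / s.
Proof.
move=> m0 Pm /[dup] s01 /andP[s0 s1]; have o0 := ball_vol_gt0 R N.
have N0 : 0 < N%:R :> R by rewrite ltr0n (leq_trans _ N2).
(* [w = m / s] makes both terms of [weighted_profile_le] at most a constant
   times [m^N]. *)
have w0 : 0 < m / s by rewrite divr_gt0.
suff H b : `|b| <= 1 -> b * profile' u i0 s <= K * m ^+ 2 / s.
  rewrite ler_norml -[X in _ && X]mul1r; apply/andP; split; last first.
    by have := H 1; rewrite normr1 mul1r; exact.
  by rewrite lerNl -mulN1r H// normrN1.
move=> b1; have := weighted_profile_le w0 s01 b1.
have -> : (m / s) ^+ N * s ^+ N = m ^+ N by rewrite -exprMn divfK// gt_eqF.
have P1 : Phi s <= m ^+ N.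
  apply: le_trans Pm; apply: ball_integral_le.
  - exact: lap_pow_ge0.
  - exact: continuous_lap_pow.
  - exact: lap_int.
  - exact: ltW.
move=> /le_trans/(_ (_ : _ <= K * m ^+ N)) => H.
have {}H : b * (m / s) ^+ (N - 2) * (s ^+ N.-1 * profile' u i0 s) <= K * m ^+ N.
  apply: H; rewrite /K mulrAC ler_wpM2r ?invr_ge0 ?ler0n// mulrDl mul1r lerD2l.
  by rewrite mulrC ler_wpM2l// invr_ge0 ltW.
rewrite -(@ler_pM2l _ (m ^+ (N - 2) * s)); last by rewrite mulr_gt0// exprn_gt0.
have -> : m ^+ (N - 2) * s * (K * m ^+ 2 / s) = K * m ^+ N.
  by rewrite -[in RHS](subnK N2) exprD; field; rewrite gt_eqF.
apply: le_trans H; rewrite le_eqVlt; apply/orP; left; apply/eqP.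
have -> : N.-1 = (N - 2).+1 by case: (N) N2 => [|[|n]]//= _; rewrite subn2.
rewrite exprMn exprS exprVn; field.
by rewrite expf_neq0// gt_eqF.
Qed.

Lemma profile_le (m r : R) : u (delta_mx ord0 i0) = 0 ->
  0 < m -> Phi 1 <= m ^+ N -> 0 < r < 1 ->
  `|profile u i0 r| <= K * m ^+ 2 * - ln r.
Proof.
move=> u0 m0 Pm /andP[r0 r1].
have H b : `|b| <= 1 -> K * m ^+ 2 * ln r <= b * profile u i0 r.
  move=> b1.
  pose h := (K * m ^+ 2) \*: @ln R - b \*: profile u i0.
  have : h r <= h 1.
    apply: (derive_ge0_le (ltW r1)
      (dh := fun t => K * m ^+ 2 / t - b * profile' u i0 t)) => t /andP[rt t1].
      have t0 := lt_le_trans r0 rt.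
      exact: is_deriveB (is_deriveZ _ (is_derive1_ln t0))
        (is_deriveZ _ (is_derive_profile i0 u2 t)).
    rewrite subr_ge0; have := @profile'_le m t m0 Pm.
    rewrite (lt_trans r0 rt) t1 => /(_ isT); apply: le_trans.
    by rewrite (le_trans (ler_norm _))// normrM ler_piMl.
  rewrite /h !fctE/= /profile scale1r u0 ln1 /GRing.scale/= !mulr0 subr0.
  by rewrite subr_le0.
have := H 1; have := H (-1).
rewrite normrN1 normr1 lexx mul1r mulN1r => /(_ isT) h1 /(_ isT) h2.
by rewrite ler_norml mulrN opprK h2/= lerNr.
Qed.

End pointwise_bound.

(** * Integrability of the logarithmic weight *)

Lemma sum_inv_sqr_le (R : realType) n :
  \sum_(k < n) (k.+1%:R ^+ 2)^-1 <= 2 - 2 / n.+1%:R :> R.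
Proof.
elim: n => [|n IH]; first by rewrite big_ord0 divr1 subrr.
rewrite big_ord_recr/= (le_trans (lerD IH (lexx _)))//.
have n0 : 0 < n.+1%:R :> R by [].
have y1 : 1 <= n.+1%:R :> R by rewrite ler1n.
rewrite [n.+2%:R]mulrSr; move: (n.+1%:R : R) n0 y1 => y y0 y1.
rewrite -subr_ge0 (_ : _ - _ = (y - 1) / (y ^+ 2 * (y + 1))).
  by rewrite divr_ge0 ?subr_ge0// mulr_ge0 ?exprn_ge0 ?addr_ge0// ltW.
by field; rewrite !gt_eqF// addr_gt0.
Qed.

Lemma measurable_invr_ge0 (R : realType) d (T : measurableType d) (D : set T)
    (f : T -> R) :
  (forall x, 0 <= f x) -> measurable_fun D f ->
  measurable_fun D (fun x => (f x)^-1).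
Proof.
move=> f0 mf; rewrite (_ : (fun x => _) = (fun x => f x `^ (-1))); last first.
  by apply/funext => x; rewrite powR_inv1.
exact: measurableT_comp (measurable_powR _) mf.
Qed.

Section log_weight.
Context (R : realType) (N : nat) (a beta : R).
Hypothesis a1 : 1 < a.
Local Notation mu := (lebesgue_rV R N).

Definition log_weight (x : 'rV[R]_N) := enorm x ^+ N * ln (a / enorm x) `^ beta.

Lemma log_weight_ge0 x : 0 <= log_weight x.
Proof. by rewrite mulr_ge0 ?exprn_ge0 ?enorm_ge0 ?powR_ge0. Qed.

Lemma measurable_ln_div :
  measurable_fun [set: 'rV[R]_N] (fun x => ln (a / enorm x)).
Proof.
apply: measurableT_comp; first exact: measurable_ln.
apply: measurable_funM => //; apply: measurable_invr_ge0 => [x|].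
  exact: enorm_ge0.
exact: measurable_enorm.
Qed.

Lemma measurable_log_weightV :
  measurable_fun [set: 'rV[R]_N] (fun x => (log_weight x)^-1).
Proof.
apply: measurable_invr_ge0 => [x|]; first exact: log_weight_ge0.
apply: measurable_funM.
  by apply: measurable_funX; exact: measurable_enorm.
exact: measurableT_comp (measurable_powR _) measurable_ln_div.
Qed.

Lemma expR_annulus (r : R) : 0 < r < 1 ->
  exists k, expR (- k.+1%:R) <= r < expR (- k%:R).
Proof.
move=> /andP[r0 r1].
have ex : exists k, expR (- k.+1%:R) <= r.
  have /archi_boundP : 0 <= - ln r by rewrite oppr_ge0 ln_le0// ltW.
  set k := Num.bound _ => kr; exists k.
  rewrite -[leRHS](lnK r0) ler_expR lerNl (le_trans (ltW kr))// ler_nat.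
  exact: leqnSn.
exists (ex_minn ex); case: ex_minnP => -[|k] -> kmin /=.
  by rewrite oppr0 expR0.
by rewrite ltNge; apply/negP => /kmin; rewrite ltnn.
Qed.

Hypothesis N0 : (0 < N)%N.
Variable p : R.
Hypothesis pb : p + 2 <= beta.

Let W (x : 'rV[R]_N) := ln (a / enorm x) `^ p / log_weight x.

Lemma measurable_log_ratio : measurable_fun setT (fun x => (W x)%:E).
Proof.
apply/measurable_EFinP.
apply: measurable_funM; last exact: measurable_log_weightV.
exact: measurableT_comp (measurable_powR _) measurable_ln_div.
Qed.

Let A k := [set x : 'rV[R]_N | expR (- k.+1%:R) <= enorm x < expR (- k%:R)].
Let c := Num.min 1 (ln a).
Let M := c `^ (p - beta) * expR N%:R * ball_vol R N.

Lemma log_ratio_annulus k :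
  (\int[mu]_(x in A k) (W x)%:E <= (M * (k.+1%:R ^+ 2)^-1)%:E)%E.
Proof.
have mA : measurable (A k) by exact: measurable_annulus.
have c0 : 0 < c by rewrite lt_min ltr01 ln_gt0.
pose B := (c * k.+1%:R) `^ (p - beta) * expR (k.+1%:R) ^+ N.
apply: (@le_trans _ _ (\int[mu]_(x in A k) (cst B%:E x))%E).
  apply: ge0_le_integral => //.
  - by move=> x _; rewrite lee_fin divr_ge0 ?powR_ge0 ?log_weight_ge0.
  - exact: measurable_funS measurable_log_ratio.
  - move=> x /andP[xl xh]; rewrite lee_fin /W /log_weight invfM mulrCA.
    have x0 : 0 < enorm x by apply: lt_le_trans xl; exact: expR_gt0.
    have a0 : 0 < a by exact: lt_trans a1.
    have L : c * k.+1%:R <= ln (a / enorm x).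
      rewrite ln_div ?posrE// mulrSr mulrDr mulr1 addrC.
      rewrite lerD ?ge_min ?lexx ?orbT//.
      rewrite lerNr -ler_expR lnK ?posrE// (le_trans (ltW xh))// ler_expR lerN2.
      by rewrite ler_piMl// ge_min lexx.
    have L0 : 0 < ln (a / enorm x) by apply: lt_le_trans L; rewrite mulr_gt0.
    rewrite -powRN -powRD; last by rewrite (gt_eqF L0) implybT.
    rewrite mulrC ler_pM ?powR_ge0 ?invr_ge0 ?exprn_ge0 ?enorm_ge0//.
      rewrite -[p - beta]opprK 2!(powRN _ (- _)).
      rewrite lef_pV2 ?posrE ?powR_gt0 ?mulr_gt0//.
      rewrite ge0_ler_powR ?nnegrE//; [|by rewrite mulr_ge0// ltW|exact: ltW].
      by rewrite opprB subr_ge0 (le_trans _ pb)// lerDl.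
    rewrite -exprVn lerXn2r ?nnegrE ?invr_ge0 ?expR_ge0 ?enorm_ge0//.
    by rewrite -[leRHS]invrK -expRN lef_pV2 ?posrE ?expR_gt0.
rewrite integral_cst//.
apply: (@le_trans _ _ (B%:E * (expR (- k%:R) ^+ N * ball_vol R N)%:E)%E).
  apply: lee_wpmul2l.
    by rewrite lee_fin mulr_ge0 ?powR_ge0 ?exprn_ge0 ?expR_ge0.
  rewrite -lebesgue_rV_ball ?expR_gt0//; apply: le_measure; rewrite ?inE//.
    exact: (@measurable_enorm_preimage _ _ `]-oo, _[%classic).
  by move=> x /andP[].
rewrite -EFinM lee_fin /B /M powRM ?ler0n ?(ltW c0)//.
rewrite (_ : _ * _ * _ * (_ * _) = c `^ (p - beta) * expR N%:R *
    ball_vol R N * k.+1%:R `^ (p - beta)); last first.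
  have <- : expR k.+1%:R ^+ N * expR (- k%:R) ^+ N = expR N%:R :> R.
    rewrite -!expRM_natr -expRD; congr expR.
    by rewrite mulrSr; ring.
  ring.
apply: ler_wpM2l.
  by rewrite !mulr_ge0 ?powR_ge0 ?expR_ge0 ?(ltW (ball_vol_gt0 _ _)).
rewrite -powR_mulrn// -powRN ler_powR ?ler1n//.
by rewrite lerBlDr addrC lerBrDr.
Qed.

Lemma log_ratio_integral_lty : (\int[mu]_(x in unit_ball N) (W x)%:E < +oo)%E.
Proof.
have mA k : measurable (A k) by exact: measurable_annulus.
have tA : trivIset setT A.
  apply/trivIsetP => /= i j _ _ ij; wlog {ij} ij : i j / (i < j)%N.
    by move=> wl; move: ij; rewrite neq_ltn => /orP[/wl//|/wl]; rewrite setIC.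
  apply/seteqP; split=> x //= -[/andP[xi _] /andP[_ xj]].
  have ji : expR (- j%:R) <= expR (- i.+1%:R) :> R.
    by rewrite ler_expR lerN2 ler_nat.
  by have := lt_le_trans xj ji; rewrite ltNge xi.
have W0 x : (0 <= (W x)%:E)%E.
  by rewrite lee_fin divr_ge0 ?powR_ge0 ?log_weight_ge0.
have -> : (\int[mu]_(x in unit_ball N) (W x)%:E =
    \int[mu]_(x in \bigcup_k A k) (W x)%:E)%E.
  rewrite integral_mkcond [RHS]integral_mkcond; apply: eq_integral => x _.
  rewrite !patchE; have [x0|x0] := eqVneq (enorm x) 0.
    rewrite /W /log_weight x0 expr0n gtn_eqF//= mul0r invr0 mulr0.
    by case: ifPn => // _; case: ifPn.
  have {}x0 : 0 < enorm x by rewrite lt_def x0 enorm_ge0.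
  congr (if _ then _ else _); apply/idP/idP; rewrite !inE.
    move=> x1; have [|k xk] := @expR_annulus (enorm x); first by rewrite x0.
    by exists k.
  move=> [k _ /andP[_ xk]]; have : expR (- k%:R) <= expR 0 :> R.
    by rewrite ler_expR oppr_le0.
  by rewrite expR0; exact: lt_le_trans.
rewrite ge0_integral_bigcup//; last exact: measurable_funS measurable_log_ratio.
apply: (@le_lt_trans _ _ (M * 2)%:E); last exact: ltry.
apply: lime_le.
  by apply: is_cvg_nneseries => k _ _; exact: integral_ge0.
apply: nearW => n.
apply: (@le_trans _ _ (\sum_(0 <= k < n) (M * (k.+1%:R ^+ 2)^-1)%:E)%E).
  by apply: lee_sum => k _; exact: log_ratio_annulus.
rewrite sumEFin lee_fin -mulr_sumr ler_wpM2l//.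
  by rewrite !mulr_ge0 ?powR_ge0 ?expR_ge0 ?(ltW (ball_vol_gt0 _ _)).
by rewrite big_mkord (le_trans (sum_inv_sqr_le _ _))// gerBl divr_ge0.
Qed.

End log_weight.

(** * The inequality *)

Lemma powR_half (R : realType) (y : R) n :
  0 <= y -> y `^ (n%:R / 2) = Num.sqrt y ^+ n.
Proof.
by move=> y0; rewrite mulrC powRrM powR12_sqrt// powR_mulrn// sqrtr_ge0.
Qed.

Theorem theorem2 (R : realType) (N : nat) (beta a : R)
    (hN : (3 <= N)%N) (hbeta : N%:R + 2 < beta) (ha : 1 < a) :
  exists2 C : R, 0 < C &
    forall u : 'rV[R]_N -> R, Cc 2 (unit_ball N) u -> radial u ->
      (C%:E * \int[lebesgue_rV R N]_(x in unit_ball N)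
         (`|u x| `^ (N%:R / 2) /
          (enorm x ^+ N * ln (a / enorm x) `^ beta))%:E
       <= \int[lebesgue_rV R N]_(x in unit_ball N)
         (`|laplacian u x| `^ (N%:R / 2))%:E)%E.
Proof.
have N2 : (2 <= N)%N by exact: ltnW.
have N0 : (0 < N)%N by exact: ltnW.
pose i0 := Ordinal N0.
pose mu := lebesgue_rV R N.
have mB : measurable (unit_ball N : set 'rV[R]_N).
  exact: (@measurable_enorm_preimage _ _ `]-oo, 1[%classic).
set p := N%:R / 2.
have p0 : 0 <= p by rewrite divr_ge0.
have pb : p + 2 <= beta.
  by rewrite (le_trans _ (ltW hbeta))// lerD2r ler_pdivrMr// ler_peMr// ler1n.
pose K := (1 + (ball_vol R N)^-1) / N%:R.
have K0 : 0 <= K by rewrite divr_ge0// addr_ge0// invr_ge0 ltW// ball_vol_gt0.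
pose W (x : 'rV[R]_N) := ln (a / enorm x) `^ p / log_weight a beta x.
have W0 x : 0 <= W x by rewrite divr_ge0 ?powR_ge0 ?log_weight_ge0.
have mW := measurable_log_ratio (N := N) a beta p.
have Woo := log_ratio_integral_lty ha N0 pb.
pose D := fine (\int[mu]_(x in unit_ball N) (W x)%:E)%E.
have DE : (\int[mu]_(x in unit_ball N) (W x)%:E)%E = D%:E.
  by rewrite fineK// ge0_fin_numE// integral_ge0// => x _; rewrite lee_fin.
have D0 : 0 <= D by rewrite fine_ge0// integral_ge0// => x _; rewrite lee_fin.
have KD0 : 0 <= K `^ p * D by rewrite mulr_ge0 ?powR_ge0.
have C0 : 0 < K `^ p * D + 1 by rewrite ltr_wpDl.
exists (K `^ p * D + 1)^-1; first by rewrite invr_gt0.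
move=> u [u2 _ su] ru.
rewrite [leRHS](_ : _ =
  \int[mu]_(x in unit_ball N) (lap_pow u i0 (enorm x))%:E)%E; last first.
  apply: eq_integral => x _; rewrite (lap_profileE i0 u2 ru).
  by rewrite powR_half ?normr_ge0.
have [lap_oo|] :=
  ltP (\int[mu]_(x in unit_ball N) (lap_pow u i0 (enorm x))%:E)%E +oo%E;
  last first.
  by rewrite leye_eq => /eqP ->; rewrite leey.
have u0 : u (delta_mx ord0 i0) = 0.
  apply: contrapT => /eqP un0.
  have /su : supp u (delta_mx ord0 i0) by exact: subset_closure.
  by rewrite /unit_ball/= enorm_delta ltxx.
(* The slack [e] makes [S], hence [m], positive. *)
apply/lee_addgt0Pr => e e0.
have phi0 := @lap_pow_ge0 R N u i0.
have cphi := @continuous_lap_pow R N u i0 u2.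
have IE := ball_integralE phi0 cphi lap_oo (lexx 1).
rewrite -[X in (X + _)%E]IE -EFinD.
set S := ball_integral _ _ _ + e.
have S0 : 0 < S by rewrite ltr_wpDl//; exact: ball_integral_ge0.
pose m := S `^ (N%:R^-1).
have m0 : 0 < m by exact: powR_gt0.
have mN : m ^+ N = S.
  by rewrite -powR_mulrn ?ltW// -powRrM mulVf ?powRr1 ?ltW// pnatr_eq0 -lt0n.
have um : measurable_fun setT u.
  rewrite (_ : u = profile u i0 \o enorm (N:=N)); last first.
    by apply/funext => x /=; exact: profileE.
  apply: measurableT_comp; last exact: measurable_enorm.
  apply: continuous_measurable_fun => t.
  apply/differentiable_continuous/derivable1_diffP.
  by have [] := is_derive_profile i0 u2 t.
have mnu : measurable_fun setT (fun x => `|u x|).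
  by apply: measurableT_comp um; exact: normr_measurable.
have uW x : unit_ball N x ->
    `|u x| `^ p / log_weight a beta x <= K `^ p * S * W x.
  move=> x1; have [x0|x0] := eqVneq (enorm x) 0.
    (* At the origin both weights are [0^-1 = 0]. *)
    by rewrite /W /log_weight x0 expr0n gtn_eqF//= mul0r invr0 !mulr0.
  have {}x0 : 0 < enorm x by rewrite lt_def x0 enorm_ge0.
  have a0 : 0 < a by exact: lt_trans ha.
  rewrite /W mulrA ler_wpM2r ?invr_ge0 ?log_weight_ge0//.
  have L0 : 0 <= ln (a / enorm x).
    by rewrite ln_ge0// ler_pdivlMr// mul1r (le_trans (ltW x1))// ltW.
  have -> : K `^ p * S * ln (a / enorm x) `^ p =
      (K * m ^+ 2 * ln (a / enorm x)) `^ p.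
    rewrite (powRM p (mulr_ge0 K0 (sqr_ge0 m)) L0) (powRM p K0 (sqr_ge0 m)).
    congr (_ * _ * _).
    by rewrite powR_half ?sqr_ge0// sqrtr_sqr gtr0_norm// mN.
  have Km0 : 0 <= K * m ^+ 2 by exact: mulr_ge0 K0 (sqr_ge0 m).
  apply: (ge0_ler_powR p0); rewrite ?nnegrE.
  - exact: normr_ge0.
  - exact: mulr_ge0.
  rewrite (profileE i0 ru).
  have xI : 0 < enorm x < 1 by rewrite x0.
  apply: le_trans (profile_le N2 u2 ru lap_oo u0 m0 _ xI) _.
    by rewrite mN lerDl ltW.
  rewrite ler_wpM2l//.
  by rewrite ln_div ?posrE// lerDr ltW// ln_gt0.
apply: (@le_trans _ _ ((K `^ p * D + 1)^-1%:E * (K `^ p * S * D)%:E)%E).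
  rewrite lee_pmul2l ?lte_fin ?invr_gt0// [leRHS]EFinM -DE.
  rewrite -ge0_integralZl_EFin//; last 3 first.
  - by move=> x _; rewrite lee_fin.
  - exact: measurable_funS mW.
  - by rewrite mulr_ge0 ?powR_ge0// ltW.
  apply: ge0_le_integral => //.
  - by move=> x _; rewrite lee_fin divr_ge0 ?powR_ge0// log_weight_ge0.
  - apply: (@measurable_funS _ _ _ _ setT) => //; apply/measurable_EFinP.
    apply: measurable_funM; last exact: measurable_log_weightV.
    exact: measurableT_comp (measurable_powR _) mnu.
  - apply: (@measurable_funS _ _ _ _ setT) => //.
    by apply: measurable_funeM; exact: mW.
rewrite -EFinM lee_fin ler_pdivrMl// mulrAC ler_wpM2r ?ltW//.
by rewrite ltrDl.
Qed.
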